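(* Let $X$ be a complete metric space, $\Gamma$ a group of homeomorphisms of $X$, and $Y\subseteq X$ a $\Gamma$-invariant set. Let $\mathcal{U}$ be the family of open sets $U\subseteq X$ for which there is no finite set $\Delta\subseteq\Gamma$ such that $Y\subseteq\Delta\cdot U$. Let $\langle R_n\mid n\in\mathbb{N}\rangle$ be an increasing sequence of reflexive symmetric closed subsets of $X\times X$. Suppose there is a compact $\mathcal{I}_{\mathcal{U}}$-positive set $K\subseteq X$ such that: (a) for all $n\in\mathbb{N}$ and all $x\in K$ there is $\gamma\in\Gamma$ such that $(x,\gamma\cdot x)\notin R_n^{(2)}$; (b) for all $\gamma\in\Gamma$ there is $n\in\mathbb{N}$ such that for all $x\in K$, $(x,\gamma\cdot x)\in R_n$; (c) for all $\gamma\in\Gamma$, all $x,y\in\Gamma\cdot K$ and all $n\in\mathbb{N}$, if $x\mathrel{R_n}y$ then $\gamma\cdot x\mathrel{R_n}\gamma\cdot y$. Then for some $x\in K$ there is a continuous injective map $\phi:2^{\omega}\to\overline{\Gamma\cdot x}$ which is a homomorphism from the pair $(\mathbb{E}_0,{\sim}\mathbb{E}_0)$ to the pair $(E_\Gamma^X,{\sim}\bigcup_{n\in\mathbb{N}}R_n)$; that is, for all $c,d\in 2^\omega$: if $c\mathrel{\mathbb{E}_0}d$ then $\phi(c)\mathrel{E_\Gamma^X}\phi(d)$, and if $\neg(c\mathrel{\mathbb{E}_0}d)$ then $(\phi(c),\phi(d))\notin\bigcup_{n\in\mathbb{N}}R_n$.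
   Context: For a family $\mathcal{U}$ of open subsets of a topological space $X$, $\mathcal{I}_{\mathcal{U}}$ is the family of sets $F\subseteq X$ such that for every $U\in\mathcal{U}$ there is an open $V\supseteq F$ with $V\cup U\in\mathcal{U}$. A set $F\subseteq X$ is $\mathcal{I}_{\mathcal{U}}$-positive if $F\notin\mathcal{I}_{\mathcal{U}}$. $\Delta\cdot U=\bigcup_{\delta\in\Delta}\delta\cdot U$ (similarly $\Gamma\cdot K$, $\Gamma\cdot x$). $\overline{Z}$ is topological closure and ${\sim}Z$ is complement. $R^{(k)}$ is the $k$-fold composition of the relation $R$ with itself: $x\mathrel{R^{(k)}}y$ iff there are $x=z_0,z_1,\dots,z_k=y$ in $X$ with $z_i\mathrel{R}z_{i+1}$ for $i<k$. $\mathbb{E}_0$ is the equivalence relation on $2^\omega$ of eventual equality: $c\mathrel{\mathbb{E}_0}d$ iff there is $n$ with $c(m)=d(m)$ for all $m>n$. $E_\Gamma^X$ is the orbit equivalence relation of $\Gamma$ on $X$. *)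

(* Defs.v *)
From HB Require Import structures.
From mathcomp Require Import all_boot all_order all_algebra.
From mathcomp Require Import all_classical all_reals all_analysis.

Set Implicit Arguments.
Unset Strict Implicit.
Unset Printing Implicit Defensive.

Local Open Scope classical_set_scope.

(* Complete includes a distinguished point, so the empty space is excluded *)
#[short(type="completeMetricType")]
HB.structure Definition CompleteMetric (K : numFieldType) :=
  { M of Metric K M & Complete M }.

Definition homeomorphism (X : topologicalType) (f : X -> X) : Prop :=
  continuous f /\
  exists g : X -> X, [/\ continuous g, cancel f g & cancel g f].

Definition homeomorphism_group (X : topologicalType) (G : set (X -> X)) : Prop :=
  [/\ forall f, G f -> homeomorphism f,
      G id,
      forall f g, G f -> G g -> G (f \o g) &
      forall f, G f -> exists g, [/\ G g, cancel f g & cancel g f]].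

(* D . U, the union of the translates d . U for d in D *)
Definition translates (X : Type) (D : set (X -> X)) (U : set X) : set X :=
  \bigcup_(d in D) (d @` U).

Definition invariant_set (X : Type) (G : set (X -> X)) (Y : set X) : Prop :=
  forall g, G g -> g @` Y = Y.

Definition orbit_of (X : Type) (G : set (X -> X)) (x : X) : set X :=
  [set g x | g in G].

Definition orbit_rel (X : Type) (G : set (X -> X)) : set (X * X) :=
  [set xy | orbit_of G xy.1 xy.2].

Definition noncovering_opens (X : topologicalType) (G : set (X -> X))
    (Y : set X) : set (set X) :=
  [set U | open U /\
    ~ exists D : set (X -> X),
        [/\ finite_set D, D `<=` G & Y `<=` translates D U]].

Definition ideal_of (X : topologicalType) (UU : set (set X)) : set (set X) :=
  [set F | forall U, UU U -> exists V, [/\ open V, F `<=` V & UU (V `|` U)]].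

Definition ideal_positive (X : topologicalType) (UU : set (set X)) (F : set X)
  : Prop := ~ ideal_of UU F.

(* the k-fold composition of R with itself; only the values z 0, ..., z k of
   the sequence matter *)
Definition rel_power (X : Type) (R : set (X * X)) (k : nat) : set (X * X) :=
  [set xy | exists z : nat -> X,
    [/\ z 0 = xy.1, z k = xy.2 & forall i, (i < k)%N -> R (z i, z i.+1)]].

Definition E0 : set (cantor_space * cantor_space) :=
  [set cd | exists n : nat, forall m : nat, (n < m)%N -> cd.1 m = cd.2 m].

Definition homomorphism_pair (S T : Type) (A B : set (S * S))
    (A' B' : set (T * T)) (phi : S -> T) : Prop :=
  (forall c d, A (c, d) -> A' (phi c, phi d)) /\
  (forall c d, B (c, d) -> B' (phi c, phi d)).

(* Main.v *)
(** The compact set K meets a closed G-invariant set D that is covered by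
    finitely many translates of every neighbourhood of K: take the points all of
    whose translates lie in the sets E . cl(V) with V a neighbourhood of K and E
    finite such that Y is contained in E . (V `|` U), where U witnesses that K
    is positive.  For a minimal such D, any x in D and K is recurrent: its orbit
    is covered by finitely many translates of every neighbourhood V of x.

    If every return of x to V were R_n-close to x, then finitely many
    translations, R_m-close to the identity on K by (b), would put the whole
    orbit of x within R_m^(2) of x, against (a).  By (c) the same argument gives
    a return g x in V with (s x, t g x) outside R_n for all s, t in a prescribed
    finite subset of G.  Iterating with shrinking neighbourhoods yields
    g_0, g_1, ..., and phi(c) is the limit of the points
    g_0^c(0) ... g_(n-1)^c(n-1) x. *)
Require Import Defs.
From mathcomp Require Import all_boot all_order all_algebra finmap.
From mathcomp Require Import all_classical all_reals all_analysis.

Import Order.TTheory Num.Theory.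

Local Open Scope classical_set_scope.

(** * Compactness: finite subcovers, regularity around a compact set, chains of closed sets *)

Lemma compact_finite_subcover {X : ptopologicalType} {I : Type} (K : set X)
    (D : set I) (f : I -> set X) :
  compact K -> (forall i, D i -> open (f i)) -> K `<=` \bigcup_(i in D) f i ->
  exists2 D' : set I, finite_set D' /\ D' `<=` D & K `<=` \bigcup_(i in D') f i.
Proof.
rewrite compact_cover => cK fo Kf.
have [D' D'D KD'] := cK {classic I} D f fo Kf.
exists [set` D'] => //; split; first exact: (@finite_fset {classic I} D').
by move=> i /= iD'; have := D'D i iD'; rewrite in_setE.
Qed.

(** Regularity gives the inclusion pointwise. Compactness leaves finitely many neighbourhoods, and
    the finite union of their closures is closed. *)
Lemma compact_open_regular {X : puniformType} {K V : set X} :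
  compact K -> open V -> K `<=` V ->
  exists2 W, open W /\ K `<=` W & closure W `<=` V.
Proof.
move=> cK oV KV.
have [|x Kx|F [Ffin FO] KF] :=
  @compact_finite_subcover X _ K [set O | open O /\ closure O `<=` V] id cK.
- by move=> O [].
- have [B xB BV] := uniform_regular (open_nbhs_nbhs (conj oV (KV _ Kx))).
  exists B° => /=; last exact: xB.
  split; first exact: open_interior.
  exact: subset_trans (closure_subset (@interior_subset _ B)) BV.
exists (\bigcup_(O in F) O).
  by split=> //; apply: bigcup_open => O /FO [].
move=> x clx; have : closed (\bigcup_(O in F) closure O).
  by apply: closed_bigcup => // O _; exact: closed_closure.
move=> /(_ x) []; last by move=> O /FO [_ clOV] /clOV.
move: clx; apply: closure_subset => z [B FB Bz].
by exists B => //; exact: subset_closure.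
Qed.

(** The traces on [K] form a proper filter base because the sets are nested; a cluster point in [K]
    lies in each closed [F i]. *)
Lemma compact_chain_bigcap {X : topologicalType} {I : Type} (K : set X)
    (A : set I) (F : I -> set X) :
  compact K -> A !=set0 ->
  (forall i, A i -> closed (F i) /\ F i `&` K !=set0) ->
  (forall i j, A i -> A j -> F i `<=` F j \/ F j `<=` F i) ->
  (\bigcap_(i in A) F i) `&` K !=set0.
Proof.
move=> cK [i0 Ai0] FK tot; pose B i := F i `&` K.
have Bf : Filter (filter_from A B).
  apply: filter_from_filter; first by exists i0.
  move=> i j Ai Aj; have [ij|ji] := tot i j Ai Aj.
    by exists i => // x [Fx Kx]; split; split=> //; exact: ij.
  by exists j => // x [Fx Kx]; split; split=> //; exact: ji.
have Bp : ProperFilter (filter_from A B).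
  by apply: filter_from_proper => i /FK [].
have [|p [Kp clp]] := cK _ Bp; first by exists i0 => // x [].
exists p; split=> // i Ai; apply: (FK i Ai).1 => N pN.
have [|z [[Fz _] Nz]] := clp (B i) N _ pN; first by exists i.
by exists z.
Qed.

(** * Coverings by finitely many translates under a group of homeomorphisms *)

Section Translates.
Context {X : topologicalType} {G : set (X -> X)} (hG : homeomorphism_group G).
Implicit Types (A B C V : set X) (D : set (X -> X)).

(** For [A] an orbit and [B] a neighbourhood of its base point, this is syndeticity of the set of
    return times. *)
Definition fin_covered A B :=
  exists D, [/\ finite_set D, D `<=` G & A `<=` translates D B].

Definition stable A := forall g x, G g -> A x -> A (g x).

Lemma group_inv {g} : G g -> exists h, [/\ G h, cancel g h & cancel h g].
Proof. by case: hG => _ _ _; apply. Qed.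

Lemma group_continuous {g} : G g -> continuous g.
Proof. by case: hG => + _ _ _ => /[apply] -[]. Qed.

Lemma group_id : G id.
Proof. by case: hG. Qed.

Lemma group_comp {f g} : G f -> G g -> G (f \o g).
Proof. by case: hG => _ _ + _; apply. Qed.

Lemma invariant_stable A : invariant_set G A -> stable A.
Proof. by move=> iA g x Gg Ax; rewrite -(iA g Gg); exists x. Qed.

Lemma image_cancel {g h : X -> X} A :
  cancel g h -> cancel h g -> g @` A = h @^-1` A.
Proof.
move=> gK hK; apply/seteqP; split=> [_ [x Ax <-]|y Ay]; first by rewrite /= gK.
by exists (h y).
Qed.

Lemma open_translates D V : D `<=` G -> open V -> open (translates D V).
Proof.
move=> DG oV; apply: bigcup_open => g /DG /group_inv [h [Gh gK hK]].
rewrite (image_cancel _ gK hK); apply: open_comp => // x _.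
exact: group_continuous.
Qed.

Lemma closed_image g A : G g -> closed A -> closed (g @` A).
Proof.
move=> /group_inv [h [Gh gK hK]] cA; rewrite (image_cancel _ gK hK).
by apply: preimage_closed => // x _; exact: group_continuous.
Qed.

Lemma closed_translates D A :
  finite_set D -> D `<=` G -> closed A -> closed (translates D A).
Proof.
by move=> Dfin DG cA; apply: closed_bigcup => // g /DG Gg; exact: closed_image.
Qed.

Lemma stable_translates A : stable (translates G A).
Proof.
by move=> g _ Gg [h Gh [x Ax <-]]; exists (g \o h); [exact: group_comp|exists x].
Qed.

Lemma stableC A : stable A -> stable (~` A).
Proof.
move=> sA g x Gg nAx Agx; apply: nAx; have [h [Gh gK _]] := group_inv Gg.
by rewrite -[x]gK; exact: sA.
Qed.

Lemma sub_fin_covered A B : A `<=` B -> fin_covered A B.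
Proof.
move=> AB; exists [set id]; split; first exact: finite_set1.
  by move=> _ ->; exact: group_id.
by move=> x Ax; exists id => //; exists x => //; exact: AB.
Qed.

Lemma fin_covered_subl {A B C} : A `<=` B -> fin_covered B C -> fin_covered A C.
Proof. by move=> AB [D [? ? BD]]; exists D; split=> // x /AB /BD. Qed.

Lemma fin_covered_trans {A B C} :
  fin_covered A B -> fin_covered B C -> fin_covered A C.
Proof.
move=> [D [Dfin DG AD]] [E [Efin EG BE]].
exists [set f \o g | f in D & g in E]; split; first exact: finite_image2.
  by move=> _ [f Df [g Eg <-]]; apply: group_comp; [exact: DG|exact: EG].
move=> x /AD [f Df [y /BE [g Eg [z Cz <-]] <-]].
by exists (f \o g); [exists f => //; exists g|exists z].
Qed.

Lemma fin_covered_bigcup {I : Type} {J : set I} {F : I -> set X} {B} :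
  finite_set J -> (forall i, J i -> fin_covered (F i) B) ->
  fin_covered (\bigcup_(i in J) F i) B.
Proof.
move=> Jfin FB.
have /choice [D DP] : forall i, exists D, J i ->
    [/\ finite_set D, D `<=` G & F i `<=` translates D B].
  by move=> i; have [/FB [D]|] := pselect (J i); [exists D|exists set0].
exists (\bigcup_(i in J) D i); split.
- by apply: bigcup_finite => // i /DP [].
- by move=> g [i /DP [_ + _]]; apply.
- move=> x [i Ji]; have [_ _ FD] := DP i Ji.
  by move=> /FD [g Dg gx]; exists g => //; exists i.
Qed.

Lemma fin_coveredU {A B C} :
  fin_covered A C -> fin_covered B C -> fin_covered (A `|` B) C.
Proof.
move=> AC BC; rewrite -bigcup2inE; apply: fin_covered_bigcup.
  exact: finite_II.
by case=> [|[|]].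
Qed.

Lemma fin_covered_translates D A :
  finite_set D -> D `<=` G -> fin_covered (translates D A) A.
Proof. by move=> Dfin DG; exists D; split. Qed.

End Translates.
Arguments fin_covered {X} G A B.
Arguments stable {X} G A.

(** * Minimal invariant sets meeting the compact set, and recurrence *)

Section Syndetic.
Context {X : puniformType} {G : set (X -> X)} (hG : homeomorphism_group G).
Context {K : set X} (K_compact : compact K).
Implicit Types (A B D V : set X).

Lemma compact_fin_covered A V :
  compact A -> open V -> A `<=` translates G V -> fin_covered G A V.
Proof.
move=> cA oV AV.
have [g Gg||E [Efin EG] AE] := compact_finite_subcover A G (fun g => g @` V) cA.
- have [h [Gh gK hK]] := group_inv hG Gg.
  rewrite (image_cancel _ gK hK); apply: open_comp => // x _.
  apply: (group_continuous hG Gh).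
- exact: AV.
- by exists E; split.
Qed.

(** A class suited to Zorn's lemma: the covering clause passes to subsets, and meeting the compact
    set [K] passes to intersections of chains. *)
Definition syndetic_near D :=
  [/\ closed D, stable G D, D `&` K !=set0 &
      forall V, open V -> K `<=` V -> fin_covered G D V].

Lemma positive_syndetic_near (Y : set X) : invariant_set G Y ->
  ideal_positive (noncovering_opens G Y) K -> exists D, syndetic_near D.
Proof.
move=> /(@invariant_stable _ G) sY Kpos.
(* Positivity yields [U] in the family such that no [V] around [K] keeps the union in it; as that
   union is open, finitely many of its translates must cover [Y]. *)
have [U [[oU YU] KU]] : exists U, noncovering_opens G Y U /\
    forall V, open V -> K `<=` V -> fin_covered G Y (V `|` U).
  apply: contra_notP Kpos => nU U UU; apply: contrapT => nV.
  apply: nU; exists U; split=> // V oV KV; apply: contrapT => nYV.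
  by apply: nV; exists V; split=> //; split=> //; apply: openU => //; case: UU.
(* [i.1.1] is a group element, [i.1.2] a neighbourhood of [K] and [i.2] a
   finite set of translations by which it covers [Y] together with [U]. *)
pose J := [set i : (X -> X) * set X * set (X -> X) |
  [/\ G i.1.1, open i.1.2 /\ K `<=` i.1.2 &
      [/\ finite_set i.2, i.2 `<=` G & Y `<=` translates i.2 (i.1.2 `|` U)]]].
pose F (i : (X -> X) * set X * set (X -> X)) :=
    i.1.1 @^-1` translates i.2 (closure i.1.2).
have Fcl i : J i -> closed (F i).
  move=> [Gg _ [Efin EG _]]; apply: preimage_closed.
    by move=> x _; exact: (group_continuous hG).
  by apply: (closed_translates hG) => //; exact: closed_closure.
exists (\bigcap_(i in J) F i); split.
- exact: closed_bigI.
(* Precomposing the group element of an index with [h] gives another index, so the intersection is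
   invariant. *)
- move=> h x Gh Dx [[g V] E] [Gg KV YE].
  by apply: (Dx (g \o h, V, E)); split=> //; exact: (group_comp hG).
- apply: contrapT => nDK; apply: YU.
  have KF : K `<=` \bigcup_(i in J) ~` F i.
    move=> x Kx; apply: contrapT => nFx; apply: nDK; exists x; split=> // i Ji.
    by apply: contrapT => nFix; apply: nFx; exists i.
  have [i Ji|J' [J'fin J'J] KJ'] :=
      compact_finite_subcover K J (fun i => ~` F i) K_compact _ KF.
    by rewrite openC; exact: Fcl.
  have oW : open (\bigcup_(i in J') ~` F i).
    by apply: bigcup_open => i /J'J Ji; rewrite openC; exact: Fcl.
  have [E [Efin EG YE]] := KU _ oW KJ'.
  have YW : Y `<=` translates E ((\bigcup_(i in J') (Y `&` ~` F i)) `|` U).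
    move=> y Yy; have [g Eg [w Ww gwy]] := YE y Yy; exists g => //.
    exists w => //.
    case: Ww => [[i J'i nFw]|]; [left; exists i => //; split=> //|by right].
    have [h [Gh gK hK]] := group_inv hG (EG g Eg).
    by rewrite -[w]gK gwy; exact: sY.
  have YW' : fin_covered G Y ((\bigcup_(i in J') (Y `&` ~` F i)) `|` U).
    by exists E.
  apply: (fin_covered_trans hG YW'); apply: fin_coveredU; last first.
    exact: sub_fin_covered.
  apply: fin_covered_bigcup => // -[[g V] E'] /J'J [Gg _ [/= E'fin E'G YE']].
  have [h [Gh gK hK]] := group_inv hG Gg.
  (* For [w] in [Y] outside [F i], the point [g w] is in [Y] but not in the translates of
     [closure V], so the covering of [Y] puts it in a translate of [U]. *)
  apply: (@fin_covered_trans _ _ hG _ (translates E' U)).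
    exists [set h]; split; [exact: finite_set1|by move=> _ ->|].
    move=> w [Yw nFw]; exists h => //; exists (g w) => //.
    have [f E'f [v [Vv|Uv] fv]] := YE' (g w) (sY g w Gg Yw).
      by case: nFw; exists f => //; exists v => //; exact: subset_closure.
    by exists f => //; exists v.
  exact: fin_covered_translates.
- move=> V oV KV; have [W [oW KW] WV] := compact_open_regular K_compact oV KV.
  have [E [Efin EG YE]] := KU W oW KW; exists E; split=> // x Dx.
  have [|f Ef [v Wv fv]] := Dx (id, W, E); first by split=> //; exact: group_id.
  by exists f => //; exists v => //; exact: WV.
Qed.

(** Zorn's lemma for reverse inclusion. The intersection of a nonempty chain meets [K] by
    compactness and inherits coverings from any member; the empty chain is bounded by [D]. *)
Lemma minimal_syndetic_near D : syndetic_near D ->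
  exists2 E, syndetic_near E &
    forall B, syndetic_near B -> B `<=` E -> E `<=` B.
Proof.
move=> sD; pose T := {B | syndetic_near B}.
have [|||E Emin] := @ZL_preorder T (exist _ D sD)
    (fun B C : T => `[< sval C `<=` sval B >]).
- by move=> B; apply/asboolP.
- by move=> B A C /asboolP AB /asboolP CA; apply/asboolP; exact: subset_trans AB.
- move=> A Atot; have [A0|A0] := pselect (A !=set0); last first.
    by exists (exist _ D sD) => B AB; case: A0; exists B.
  suff sI : syndetic_near (\bigcap_(B in A) sval B).
    by exists (exist _ _ sI) => B AB; apply/asboolP => x; exact.
  split.
  + by apply: closed_bigI => -[B [cB ? ? ?]].
  + move=> g x Gg Ax B AB; have [_ sB _ _] := svalP B.
    by apply: sB => //; exact: Ax.
  + apply: compact_chain_bigcap => // [B _|B C AB AC].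
      by have [] := svalP B.
    by have [/asboolP|/asboolP] := Atot B C AB AC; [right|left].
  + move=> V oV KV; have [B AB] := A0; have [_ _ _ /(_ V oV KV)] := svalP B.
    by apply: fin_covered_subl => x; exact.
- exists (sval E); first exact: svalP.
  by move=> B sB BE; have /asboolP := Emin (exist _ B sB) (asboolT BE).
Qed.

Lemma syndetic_near_recurrent D : syndetic_near D -> exists2 x, K x &
  forall V, open V -> V x -> fin_covered G (orbit_of G x) V.
Proof.
move=> /minimal_syndetic_near [{}D [cD sD [x [Dx Kx]] DK] Dmin].
exists x => // V oV Vx.
(* Otherwise removing the invariant open set [translates G V] from [D] leaves a smaller set of the
   same class, which omits [x]; minimality forbids this. *)
have DKV : D `&` K `<=` translates G V.
  apply: contrapT => nDKV.
  have nV : stable G (~` translates G V).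
    exact: (stableC hG) (stable_translates hG _).
  have /Dmin/(_ (@subIsetl _ _ _))/(_ x Dx) :
      syndetic_near (D `&` ~` translates G V).
    split.
    - by apply: closedI => //; rewrite closedC; apply: (open_translates hG).
    - by move=> g y Gg [Dy ny]; split; [exact: sD|exact: nV].
    - apply: contrapT => n0; apply: nDKV => y [Dy Ky]; apply: contrapT => ny.
      by apply: n0; exists y.
    - by move=> W oW KW; apply: fin_covered_subl (DK W oW KW) => y [].
  by move=> [_]; apply; exists id; [exact: group_id|exists x].
have [E [Efin EG DE]] : fin_covered G (D `&` K) V.
  by apply: compact_fin_covered => //; rewrite setIC; exact: compact_closedI.
(* Adding the complement of [D] turns a neighbourhood of [D]&[K] into one of [K]. The orbit stays in
   the invariant set [D], so translates of the complement never contribute. *)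
have [||F [Ffin FG DF]] := DK (translates E V `|` ~` D).
- by apply: openU; [exact: (open_translates hG)|rewrite openC].
- by move=> y Ky; have [Dy|] := pselect (D y); [left; exact: DE|right].
apply: (@fin_covered_trans _ _ hG _ (translates E V)); last first.
  exact: fin_covered_translates.
exists F; split=> // _ [g Gg <-].
have [f Ff [y [Ey|nDy] fy]] := DF _ (sD g x Gg Dx).
  by exists f => //; exists y.
have [h [Gh fK hK]] := group_inv hG (FG f Ff).
by case: nDy; rewrite -[y]fK fy; exact: sD Gh (sD _ _ Gg Dx).
Qed.

End Syndetic.

(** * Far returns to the recurrent point and the recursive scheme built from them *)

Lemma filter_finite_bigcap {T I : Type} (J : set I) (P : I -> set T)
    (F : set_system T) : Filter F -> finite_set J ->
  (forall i, J i -> F (P i)) -> F (\bigcap_(i in J) P i).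
Proof.
move=> FF /(@finite_fsetP {classic I}) [A JA] FP.
rewrite JA; apply: (@filter_bigI _ {classic I}) => i iA; apply: FP.
by rewrite JA.
Qed.

Section Step.
Context {R : realType} {X : completeMetricType R}.
Context {G : set (X -> X)} (hG : homeomorphism_group G).
Context {Rn : nat -> set (X * X)}.
Context (Rn_incr : forall m n : nat, (m <= n)%N -> Rn m `<=` Rn n).
Context (Rn_closed : forall n : nat, closed (Rn n)).
Context {K : set X}.
Context (ha : forall (n : nat) (x : X), K x ->
  exists2 g, G g & ~ rel_power (Rn n) 2 (x, g x)).
Context (hb : forall g, G g ->
  exists n : nat, forall x, K x -> Rn n (x, g x)).
Context (hc : forall g, G g -> forall x y : X,
  translates G K x -> translates G K y ->
  forall n : nat, Rn n (x, y) -> Rn n (g x, g y)).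
Context {x : X} (Kx : K x).
Context (x_recurrent :
  forall V, open V -> V x -> fin_covered G (orbit_of G x) V).

Lemma orbit_translates g : G g -> translates G K (g x).
Proof. by move=> Gg; exists g => //; exists x. Qed.

Lemma return_far n (V : set X) (L : set (X -> X)) :
  open V -> V x -> finite_set L -> L `<=` G ->
  exists g, [/\ G g, V (g x) &
    forall s t, L s -> L t -> ~ Rn n (s x, t (g x))].
Proof.
move=> oV Vx Lfin LG; apply: contrapT => close.
have [E [Efin EG xE]] := x_recurrent V oV Vx.
have /choice [inv invP] : forall g, exists h, G g ->
    [/\ G h, cancel g h & cancel h g].
  move=> g; have [/(group_inv hG)[h]|] := pselect (G g); last by exists g.
  by exists h.
(* These are the maps carrying [x] to the midpoint of the two-step path below; being finitely many,
   they move [x] within a single [Rn m] by (b). *)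
pose M := [set f \o (inv st.2 \o st.1) | f in E & st in L `*` L].
have MG : M `<=` G.
  move=> _ [f Ef [[s t] [/= Ls Lt] <-]].
  have [Gi _ _] := invP t (LG t Lt).
  by apply: (group_comp hG (EG f Ef)); apply: (group_comp hG Gi); exact: LG.
have [m [nm Mm]] : exists m, (n <= m)%N /\ forall k, M k -> Rn m (x, k x).
  have : \forall m \near \oo,
      (n <= m)%N /\ (\bigcap_(k in M) [set m | Rn m (x, k x)]) m.
    apply: filterI; first exact: nbhs_infty_ge.
    apply: filter_finite_bigcap.
      by apply: finite_image2 => //; exact: finite_setX.
    move=> k /MG /hb [p Kp]; exists p => // q /= pq.
    by apply: Rn_incr pq _ _; exact: Kp.
  by move=> /filter_ex.
have [g Gg nRg] := ha m x Kx; apply: nRg.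
have [f Ef [v Vv fv]] := xE (g x) (ex_intro2 _ _ g Gg erefl).
have [Gi fK iK] := invP f (EG f Ef).
have vE : v = inv f (g x) by rewrite -fv fK.
have GI : G (inv f \o g) by exact: group_comp.
apply: contrapT => nRg; apply: close; exists (inv f \o g); split=> //.
  by rewrite /= -vE.
move=> s t Ls Lt Rst; apply: nRg.
have [Gt tK iKt] := invP t (LG t Lt).
(* The first link is the choice of [m]. The second is the assumed relation between [s x] and [t v],
   moved by [f \o inv t] with the help of (c). *)
exists (fun i => match i with
  0 => x | 1 => f (inv t (s x)) | _ => g x end).
split=> // -[_|[_|//]].
  by apply: (Mm (f \o (inv t \o s))); exists f => //; exists (s, t).
apply: Rn_incr nm _ _.
rewrite -[g x]iK -[inv f (g x)]tK.
apply: (hc _ (group_comp hG (EG f Ef) Gt)) Rst.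
  by apply: orbit_translates; exact: LG.
exact: (orbit_translates (t \o (inv f \o g)) (group_comp hG (LG t Lt) GI)).
Qed.

(** Everything required holds at [x] itself: [return_far] gives separation there, and closedness of
    [Rn n] with continuity spreads it to a neighbourhood. Regularity makes that neighbourhood
    closed. *)
Lemma shrink n (e : R) (W : set X) (L : set (X -> X)) : (0 < e)%R ->
  nbhs x W -> finite_set L -> L `<=` G ->
  exists g W', [/\ G g, nbhs x W' /\ closed W',
    W' `<=` W /\ (forall a, W' a -> W (g a)),
    forall s t a b, L s -> L t -> W' a -> W' b -> ~ Rn n (s a, t (g b)) &
    forall s a, (L `|` [set t \o g | t in L]) s -> W' a -> ball (s x) e (s a)].
Proof.
move=> e0 xW Lfin LG.
have [g [Gg Wg Lg]] :=
  return_far n W° L (open_interior W) (nbhs_singleton (nbhs_interior xW))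
    Lfin LG.
pose L' := L `|` [set t \o g | t in L]; exists g.
have L'G : L' `<=` G.
  by move=> s [/LG//|[t /LG Gt <-]]; exact: group_comp.
have nbR : nbhs (x, x) (\bigcap_(st in L `*` L)
    [set ab : X * X | ~ Rn n (st.1 ab.1, st.2 (g ab.2))]).
  apply: filter_finite_bigcap; first exact: finite_setX.
  move=> [s t] [/= Ls Lt].
  have cst : continuous (fun ab : X * X => (s ab.1, t (g ab.2))).
    move=> ab; apply: cvg_pair.
      apply: (@continuous_comp _ _ _ fst s); first exact: cvg_fst.
      exact: (group_continuous hG (LG s Ls)).
    apply: (@continuous_comp _ _ _ snd (t \o g)); first exact: cvg_snd.
    exact: (group_continuous hG (group_comp hG (LG t Lt) Gg)).
  apply: (cst (x, x) (~` Rn n)); apply: open_nbhs_nbhs; split; last exact: Lg.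
  by rewrite openC.
case: nbR => -[P Q] [/= xP xQ] PQ.
have xN : nbhs x (W `&` (g @^-1` W) `&` (P `&` Q) `&`
    \bigcap_(s in L') [set a | ball (s x) e (s a)]).
  apply: filterI; first apply: filterI; first apply: filterI => //.
  - apply: (group_continuous hG Gg); exact: Wg.
  - exact: filterI.
  - apply: filter_finite_bigcap.
      by rewrite finite_setU; split=> //; exact: finite_image.
    move=> s /L'G Gs; apply: (group_continuous hG Gs).
    exact: nbhsx_ballx.
have [B xB clB] := uniform_regular xN; exists (closure B); split=> //.
- split; last exact: closed_closure.
  by apply: filterS xB; exact: subset_closure.
- by split=> a /clB [[[]]].
- move=> s t a b Ls Lt /clB [[_ [Pa _]] _] /clB [[_ [_ Qb]] _].
  exact: (PQ (a, b) (conj Pa Qb) (s, t) (conj Ls Lt)).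
- by move=> s a L's /clB [_]; apply.
Qed.

(** The newest factor is applied first, so a later digit only moves points inside the small set
    [W n] before the earlier word acts. *)
Fixpoint word (g : nat -> X -> X) (c : cantor_space) (n : nat) : X -> X :=
  if n is m.+1 then word g c m \o (if c m then g m else id) else id.

Lemma cantor_scheme : exists (g : nat -> X -> X) (W : nat -> set X),
  (forall n, [/\ G (g n), nbhs x (W n) /\ closed (W n), W n.+1 `<=` W n &
     forall a, W n.+1 a -> W n (g n a)]) /\
  (forall n c d, (forall a b, W n.+1 a -> W n.+1 b ->
       ~ Rn n (word g c n a, word g d n (g n b))) /\
     (forall a, W n.+1 a ->
       ball (word g c n.+1 x) n.+1%:R^-1%R (word g c n.+1 a))).
Proof.
pose good (i : set X * set (X -> X)) :=
  [/\ nbhs x i.1, closed i.1, finite_set i.2 & i.2 `<=` G].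
(* If [L] contains all words of length [n], its extension contains all those of length [n.+1]; hence
   the estimates are uniform in [c] and [d]. *)
pose ext (g : X -> X) (L : set (X -> X)) := L `|` [set t \o g | t in L].
have step (i : nat * (set X * set (X -> X))) :
  exists gW : (X -> X) * set X, good i.2 ->
    [/\ G gW.1, good (gW.2, ext gW.1 i.2.2),
      gW.2 `<=` i.2.1 /\ (forall a, gW.2 a -> i.2.1 (gW.1 a)),
      forall s t a b, i.2.2 s -> i.2.2 t -> gW.2 a -> gW.2 b ->
        ~ Rn i.1 (s a, t (gW.1 b)) &
      forall s a, ext gW.1 i.2.2 s -> gW.2 a ->
        ball (s x) i.1.+1%:R^-1%R (s a)].
  case: i => n [W L]; have [[xW cW Lfin LG]|] := pselect (good (W, L)); last first.
    (* A dummy value off the good states, so that [choice] gives a total function. *)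
    by exists (id, setT).
  have [|g [W' [Gg [xW' cW'] WW sep small]]] :=
    shrink n n.+1%:R^-1%R W L _ xW Lfin LG; first by rewrite invr_gt0 ltr0n.
  exists (g, W') => _; split=> //; split=> //=.
    by rewrite finite_setU; split=> //; exact: finite_image.
  by move=> s [/LG//|[t /LG Gt <-]]; exact: group_comp.
have [f fP] := choice step.
pose st := fix st n : set X * set (X -> X) := if n is m.+1
  then ((f (m, st m)).2, ext (f (m, st m)).1 (st m).2) else (setT, [set id]).
have stg n : good (st n).
  elim: n => [|n IH]; last by have [] := fP (n, st n) IH.
  split=> /=; [exact: filterT|exact: closedT|exact: finite_set1|].
  by move=> _ ->; exact: group_id.
exists (fun n => (f (n, st n)).1), (fun n => (st n).1); split.
  move=> n; have [xW cW _ _] := stg n.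
  by have [Gg _ [WW gW] _ _] := fP (n, st n) (stg n).
have wL n c : (st n).2 (word (fun n => (f (n, st n)).1) c n).
  elim: n => [//|n IH] /=; case: (c n); last by left.
  by right; eexists; first exact: IH.
move=> n c d; have [_ _ _ sep small] := fP (n, st n) (stg n); split.
  by move=> a b; apply: sep => /=; exact: wL.
move=> a; apply: small; exact: wL n.+1 c.
Qed.

End Step.

(** * The limit map on Cantor space and its properties *)

Section Limit.
Context {R : realType} {X : completeMetricType R}.
Context {G : set (X -> X)} (hG : homeomorphism_group G).
Context {Rn : nat -> set (X * X)}.
Context (Rn_incr : forall m n : nat, (m <= n)%N -> Rn m `<=` Rn n).
Context (Rn_refl : forall (n : nat) (x : X), Rn n (x, x)).
Context (Rn_sym : forall (n : nat) (x y : X), Rn n (x, y) -> Rn n (y, x)).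
Context {x : X} {g : nat -> X -> X} {W : nat -> set X}.
Context (gG : forall n, G (g n)).
Context (W_nbhs : forall n, nbhs x (W n)).
Context (W_closed : forall n, closed (W n)).
Context (W_decr : forall n, W n.+1 `<=` W n).
Context (W_step : forall n a, W n.+1 a -> W n (g n a)).
Context (W_sep : forall n c d a b, W n.+1 a -> W n.+1 b ->
  ~ Rn n (word g c n a, word g d n (g n b))).
Context (W_small : forall n c a, W n.+1 a ->
  ball (word g c n.+1 x) n.+1%:R^-1%R (word g c n.+1 a)).

Lemma word_group c n : G (word g c n).
Proof.
elim: n => [|n IH] /=; first exact: group_id.
by apply: (group_comp hG IH); case: (c n) => //; exact: group_id.
Qed.

Lemma word_agree c d n : (forall i, (i < n)%N -> c i = d i) ->
  word g c n = word g d n.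
Proof.
elim: n => [//|n IH] cd /=; rewrite (cd n (ltnSn n)) IH // => i ni.
by apply: cd; exact: leqW.
Qed.

Lemma word_image_decr c n m : (n <= m)%N ->
  word g c m @` W m `<=` word g c n @` W n.
Proof.
elim: m => [|m IH]; first by rewrite leqn0 => /eqP ->.
rewrite leq_eqVlt => /predU1P[->//|/IH]; apply: subset_trans => _ [a Wa <-] /=.
case: (c m); first by exists (g m a) => //; exact: W_step.
by exists a => //; exact: W_decr.
Qed.

Lemma word_in_image c n m : (n <= m)%N -> (word g c n @` W n) (word g c m x).
Proof.
move=> nm; apply: (word_image_decr _ _ _ nm); exists x => //.
exact: nbhs_singleton.
Qed.

(** From stage [N.+1] on, all terms lie in the image of [W N.+1] under one word, whose points are
    within [N.+1%:R^-1] of the image of [x]. *)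
Lemma word_cvg c : cvg (word g c n x @[n --> \oo]).
Proof.
apply: cauchy_cvg; apply: cauchy_exP => e e0.
have [N _ /(_ N (leqnn N)) Ne] := near_infty_natSinv_lt (PosNum e0).
exists (word g c N.+1 x); exists N.+1 => // m /= Nm.
have [a Wa <-] := word_in_image c _ _ Nm.
by apply: le_ball (W_small _ _ _ Wa); exact: ltW.
Qed.

Definition limit_point (c : cantor_space) : X := lim (word g c n x @[n --> \oo]).

(** The image is closed, words being homeomorphisms, and contains all terms from stage [n] on. *)
Lemma limit_point_image c n : (word g c n @` W n) (limit_point c).
Proof.
apply: (closed_cvg _ _ _ _ (word_cvg c)).
  by apply: (closed_image hG); [exact: word_group|exact: W_closed].
by exists n => // m /= nm; exact: word_in_image.
Qed.

Lemma limit_point_closure c : closure (orbit_of G x) (limit_point c).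
Proof.
apply: (closed_cvg _ _ _ _ (word_cvg c)); first exact: closed_closure.
apply: nearW => n; apply: subset_closure; exists (word g c n) => //.
exact: word_group.
Qed.

Lemma cylinder_nbhs (c : cantor_space) n :
  nbhs c [set d : cantor_space | forall i, (i < n)%N -> c i = d i].
Proof.
apply: (@filter_finite_bigcap _ _ `I_n
  (fun i => [set d : cantor_space | c i = d i])).
  exact: finite_II.
move=> i _; apply: (@proj_continuous nat (fun=> bool) i c [set b | c i = b]).
apply: open_nbhs_nbhs; split=> //; exact: discrete_open.
Qed.

(** Sequences agreeing on the first [N.+1] digits share a word, and both limits are within [e / 2]
    of its value at [x]. *)
Lemma limit_point_continuous : continuous limit_point.
Proof.
move=> c; apply/cvg_ballP => e e0.
have e20 : (0 < e / 2)%R by rewrite divr_gt0.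
have [N _ /(_ N (leqnn N)) Ne] := near_infty_natSinv_lt (PosNum e20).
apply: filterS (cylinder_nbhs c N.+1) => d cd.
have near_word b : ball (word g b N.+1 x) (e / 2) (limit_point b).
  have [a Wa <-] := limit_point_image b N.+1.
  by apply: le_ball (W_small _ _ _ Wa); exact: ltW.
apply: (ball_splitr (near_word c)).
by rewrite (word_agree _ _ _ cd); exact: near_word.
Qed.

Lemma limit_point_sep n c d : c n != d n ->
  ~ Rn n (limit_point c, limit_point d).
Proof.
(* [W_sep] applies [g n] on the second side only; symmetry of [Rn n] covers the other order of
   digits. *)
wlog cn : c d / c n = false => [sep|].
  case E : (c n); last by rewrite -E; exact: sep E.
  by case F : (d n) => // _ /Rn_sym; apply: (sep d c F); rewrite E F.
rewrite cn; case E : (d n) => // _.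
have [a Wa <-] := limit_point_image c n.+1.
have [b Wb <-] := limit_point_image d n.+1.
by rewrite /= cn E; exact: W_sep.
Qed.

Lemma limit_point_injective : injective limit_point.
Proof.
move=> c d cd; apply/funext => n; apply/eqP; apply: contrapT => /negP cdn.
by apply: (limit_point_sep n c d cdn); rewrite cd; exact: Rn_refl.
Qed.

(** Undoing the prefix of [c] and applying that of [d] exchanges the approximating sequences from
    stage [n.+1] on, and by continuity also their limits. Agreement is strictly past [n], hence
    prefixes of length [n.+1]. *)
Lemma limit_point_E0 c d : E0 (c, d) ->
  orbit_rel G (limit_point c, limit_point d).
Proof.
move=> [n /= cd].
have [h [Gh wK hK]] := group_inv hG (word_group c n.+1).
have [h' [Gh' wK' hK']] := group_inv hG (word_group d n.+1).
have tails k y : h (word g c (n.+1 + k) y) = h' (word g d (n.+1 + k) y).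
  elim: k y => [|k IH] y; first by rewrite addn0 wK wK'.
  by rewrite addnS [LHS]IH /= cd // leq_addr.
have Gf : G (word g d n.+1 \o h).
  by apply: (group_comp hG) => //; exact: word_group.
exists (word g d n.+1 \o h) => //=.
apply: (cvg_unique (@metric_hausdorff R X) _ (word_cvg d)).
have : ((word g d n.+1 \o h) (word g c m x)) @[m --> \oo] -->
    (word g d n.+1 \o h) (limit_point c).
  by apply: continuous_cvg (word_cvg c); exact: (group_continuous hG Gf).
apply: cvg_trans; apply: near_eq_cvg; exists n.+1 => // m /= /subnKC <-.
by rewrite tails; exact: hK'.
Qed.

(** A relation [Rn n] between the limits persists in every [Rn m] with [m] past [n], which by
    separation forces equal digits there. *)
Lemma limit_point_nE0 c d : (~` E0) (c, d) ->
  (~` (\bigcup_(n : nat) Rn n)) (limit_point c, limit_point d).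
Proof.
move=> ncd [n _ Rcd]; apply: ncd; exists n => m nm /=.
apply/eqP; apply: contrapT => /negP /limit_point_sep; apply.
exact: Rn_incr (ltnW nm) _ Rcd.
Qed.

End Limit.

Theorem theorem2p13 (R : realType) (X : completeMetricType R)
  (G : set (X -> X)) (hG : homeomorphism_group G)
  (Y : set X) (hY : invariant_set G Y)
  (Rn : nat -> set (X * X))
  (Rn_incr : forall m n : nat, (m <= n)%N -> Rn m `<=` Rn n)
  (Rn_refl : forall (n : nat) (x : X), Rn n (x, x))
  (Rn_sym : forall (n : nat) (x y : X), Rn n (x, y) -> Rn n (y, x))
  (Rn_closed : forall n : nat, closed (Rn n))
  (K : set X) (K_compact : compact K)
  (K_positive : ideal_positive (noncovering_opens G Y) K)
  (ha : forall (n : nat) (x : X), K x ->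
    exists2 g, G g & ~ rel_power (Rn n) 2 (x, g x))
  (hb : forall g, G g -> exists n : nat, forall x, K x -> Rn n (x, g x))
  (hc : forall g, G g -> forall x y : X,
    translates G K x -> translates G K y ->
    forall n : nat, Rn n (x, y) -> Rn n (g x, g y)) :
  exists2 x, K x &
    exists phi : cantor_space -> X,
      [/\ continuous phi,
          injective phi,
          forall c, closure (orbit_of G x) (phi c) &
          homomorphism_pair E0 (~` E0)
            (orbit_rel G) (~` (\bigcup_(n : nat) Rn n)) phi].
Proof.
have [D sD] := positive_syndetic_near hG K_compact Y hY K_positive.
have [x Kx x_rec] := syndetic_near_recurrent hG K_compact D sD.
have [g [W [gW sepW]]] :=
  cantor_scheme hG Rn_incr Rn_closed ha hb hc Kx x_rec.
have gG n : G (g n) by have [] := gW n.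
have W_nbhs n : nbhs x (W n) by have [_ []] := gW n.
have W_closed n : closed (W n) by have [_ []] := gW n.
have W_decr n : W n.+1 `<=` W n by have [] := gW n.
have W_step n a : W n.+1 a -> W n (g n a) by have [_ _ _] := gW n; apply.
have W_sep n c d a b : W n.+1 a -> W n.+1 b ->
  ~ Rn n (word g c n a, word g d n (g n b)) by apply: (sepW n c d).1.
have W_small n c a : W n.+1 a ->
  ball (word g c n.+1 x) n.+1%:R^-1%R (word g c n.+1 a) by apply: (sepW n c c).2.
exists x => //; exists (@limit_point _ _ x g); split.
- exact: (limit_point_continuous hG gG W_nbhs W_closed W_decr W_step W_small).
- exact: (limit_point_injective hG Rn_refl Rn_sym gG W_nbhs W_closed W_decr W_step
    W_sep W_small).
- exact: (limit_point_closure hG gG W_nbhs W_decr W_step W_small).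
- split=> c d; first exact: (limit_point_E0 hG gG W_nbhs W_decr W_step W_small).
  exact: (limit_point_nE0 hG Rn_incr Rn_sym gG W_nbhs W_closed W_decr W_step W_sep
    W_small).
Qed.
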